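(* Let $[\boldsymbol D,\boldsymbol o]$ be a unimodular discrete space. (i) Let $\alpha,c,M>0$ and assume there exists an equivariant weight function $\boldsymbol w$ such that almost surely, for all $r\ge M$, $\boldsymbol w(N_r(\boldsymbol o))\le c\,r^\alpha$. Then $\mathcal H^\alpha_M(\boldsymbol D)\ge\frac1c\,\mathbb E[\boldsymbol w(\boldsymbol o)]$. (ii) If in addition $\boldsymbol w_{\boldsymbol D}(\boldsymbol o)>0$ with positive probability, then $\mathrm{udim}_H(\boldsymbol D)\le\alpha$.
   Context: Discrete spaces. A discrete space is a metric space $(D,d)$ in which every ball of finite radius is finite. A pointed discrete space $(D,o)$ has a distinguished point $o$ (the origin); doubly-pointed ones have two. A marked discrete space carries a function $m:D\times D\to\Xi$ with $\Xi$ a complete separable metric space; $m(x):=m(x,x)$. Isomorphisms are isometries preserving origins and marks. $\mathcal D_*,\mathcal D_{**}$ (resp. $\mathcal D'_*,\mathcal D'_{**}$) are the sets of isomorphism classes of pointed and doubly-pointed discrete spaces (resp. marked ones), with classes in brackets, and the Borel $\sigma$-field of the following metric: $1\wedge$ the infimum of $\epsilon>0$ such that, in both directions, there is an injection from the closed ball of radius $1/\epsilon$ around the origin of one space into the other, preserving origins and changing distances and marks by at most $\epsilon$. A unimodular discrete space is a random element $[\boldsymbol D,\boldsymbol o]$ of $\mathcal D_*$ such that $\mathbb E[\sum_{v\in\boldsymbol D}g[\boldsymbol D,\boldsymbol o,v]]=\mathbb E[\sum_{v\in\boldsymbol D}g[\boldsymbol D,v,\boldsymbol o]]$ for all measurable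 $g:\mathcal D_{**}\to[0,\infty)$. Equivariant processes. An equivariant process with values in $\Xi$ assigns to every deterministic discrete space $D$ a random element $\boldsymbol Z_D$ of $\Xi^{D\times D}$ (extra randomness allowed) such that (i) for every isometry $\rho:D_1\to D_2$, $\boldsymbol Z_{D_1}\circ\rho^{-1}$ has the same distribution as $\boldsymbol Z_{D_2}$; (ii) for every measurable $A\subseteq\mathcal D'_*$, $[D,o]\mapsto\mathbb P[[D,o;\boldsymbol Z_D]\in A]$ is measurable. It suffices that it be defined for almost all realizations of $\boldsymbol D$; $[\boldsymbol D,\boldsymbol o;\boldsymbol Z_{\boldsymbol D}]$ is obtained by sampling $[\boldsymbol D,\boldsymbol o]$ and then the marking. An equivariant weight function $\boldsymbol w$ is an equivariant process with values in $[0,\infty)$ (marks on points); $\boldsymbol w(S):=\sum_{v\in S}\boldsymbol w(v)$ for $S\subseteq\boldsymbol D$. Hausdorff dimension. $N_r(v)=\{u:d(u,v)\le r\}$ for $r>0$ and $N_0(v):=\emptyset$. An equivariant covering is an equivariant process $\boldsymbol R$ with values in $\{0\}\cup[1,\infty)$ on points such that the balls $N_{\boldsymbol R(v)}(v)$, $v\in\boldsymbol D$, cover $\boldsymbol D$ a.s. Let $\mathcal H^\alpha_M(\boldsymbol D)$ be the infimum of $\mathbb E[\boldsymbol R(\boldsymbol o)^\alpha]$ over all equivariant coverings $\boldsymbol R$ such that a.s. $\boldsymbol R(v)\in\{0\}\cup[M,\infty)$ for all $v\in\boldsymbol D$ ($0^0:=0$). $\mathrm{udim}_H(\boldsymbol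 D):=\sup\{\alpha\ge0:\mathcal H^\alpha_1(\boldsymbol D)=0\}$, $\sup\emptyset:=0$. *)

(* Defs.v *)
From HB Require Import structures.
From mathcomp Require Import all_boot all_order all_algebra generic_quotient.
From mathcomp Require Import all_classical all_reals all_analysis measurable_realfun.

Set Implicit Arguments.
Unset Strict Implicit.
Unset Printing Implicit Defensive.

Import Order.TTheory GRing.Theory Num.Theory.
Import numFieldNormedType.Exports.

Local Open Scope classical_set_scope.
Local Open Scope ring_scope.

(* The carrier is a bare Type rather than a metricType so that the type of all
   discrete spaces, and the quotients built from it, may live in a universe
   above the carriers and still be choiceTypes and measurableTypes. *)
Record discreteSpace (R : realType) := DiscreteSpace {
  ds_sort :> Type ;
  ds_dist : ds_sort -> ds_sort -> R ;
  ds_dist_eq0 : forall x y, ds_dist x y = 0 <-> x = y ;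
  ds_dist_sym : forall x y, ds_dist x y = ds_dist y x ;
  ds_dist_triangle : forall x y z,
    ds_dist x z <= ds_dist x y + ds_dist y z ;
  ds_finite_ball : forall x r, finite_set [set y | ds_dist x y <= r]
}.
Arguments ds_dist {R d} : rename.

Section isometry.
Variable R : realType.

Definition is_isometry (D1 D2 : discreteSpace R) (rho : D1 -> D2) : Prop :=
  bijective rho /\ forall x y, ds_dist (rho x) (rho y) = ds_dist x y.

(* The convention N_0(v) = set0 is the condition 0 < r. *)
Definition nball (D : discreteSpace R) (r : R) (v : D) : set D :=
  [set u | 0 < r /\ ds_dist v u <= r].

End isometry.

#[short(type="markType")]
HB.structure Definition MarkSpace (R : numDomainType) :=
  {T of Metric R T & PseudoPointedMetric R T}.

(* Unmarked spaces are spaces marked by the one-point space. *)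
Definition nomark (R : realType) : Type := unit.

Section nomark.
Variable R : realType.

HB.instance Definition _ := Pointed.copy (nomark R) unit.

Let nomark_dist (_ _ : nomark R) : R := 0.
Let nomark_dist_eq0 x y : nomark_dist x y = 0 -> x = y.
Proof. by case: x y => -[]. Qed.
Let nomark_distC x y : nomark_dist x y = nomark_dist y x.
Proof. by []. Qed.
Let nomark_dist_triangle (y x z : nomark R) :
  nomark_dist x z <= nomark_dist x y + nomark_dist y z.
Proof. by rewrite addr0. Qed.

HB.instance Definition _ := @isMetric.Build R (nomark R) nomark_dist
  (fun=> erefl) nomark_dist_eq0 nomark_distC nomark_dist_triangle.

End nomark.

(* Mark spaces are metric spaces in general; completeness and separability are
   not part of the structure, but the mark spaces used below (a point and the
   closed subsets [0, +oo[ and {0} `|` [1, +oo[ of R) have them. *)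
Definition realmark (R : realType) (S : pred R) (S0 : S 0) : Type :=
  {x : R | S x}.

Section realmark.
Variables (R : realType) (S : pred R) (S0 : S 0).
Notation T := (realmark S0).

HB.instance Definition _ := Choice.copy T {x : R | S x}.
HB.instance Definition _ := isPointed.Build T (exist _ 0 S0 : T).

Let rdist (x y : T) : R := `|sval x - sval y|.
Let rdistxx x : rdist x x = 0.
Proof. by rewrite /rdist subrr normr0. Qed.
Let rdist_eq0 x y : rdist x y = 0 -> x = y.
Proof. by move=> /normr0_eq0/subr0_eq; exact: val_inj. Qed.
Let rdistC x y : rdist x y = rdist y x.
Proof. exact: distrC. Qed.
Let rdist_triangle y x z : rdist x z <= rdist x y + rdist y z.
Proof. exact: ler_distD. Qed.

HB.instance Definition _ := @isMetric.Build R T rdist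
  rdistxx rdist_eq0 rdistC rdist_triangle.

End realmark.

Definition nneg_mark (R : realType) : markType R :=
  realmark (S := fun x : R => 0 <= x) (lexx 0).

Definition radius_mark (R : realType) : markType R :=
  realmark (S := fun x : R => (x == 0) || (1 <= x))
    (introT orP (or_introl (eqxx 0))).

Section classes.
Variable R : realType.

(* There are n + 1 origins: n = 0 for pointed and n = 1 for doubly-pointed
   spaces. *)
Record markedSpace (Xi : markType R) (n : nat) := MarkedSpace {
  ms_space : discreteSpace R ;
  ms_origin : 'I_n.+1 -> ms_space ;
  ms_mark : ms_space -> ms_space -> Xi
}.
Arguments ms_origin {Xi n} m : rename.
Arguments ms_mark {Xi n} m : rename.

Definition ms_iso (Xi : markType R) n (A B : markedSpace Xi n) : Prop :=
  exists rho : ms_space A -> ms_space B,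
    [/\ is_isometry rho,
        forall i, rho (ms_origin A i) = ms_origin B i &
        forall x y, ms_mark B (rho x) (rho y) = ms_mark A x y].

Section quotient.
Variables (Xi : markType R) (n : nat).
Notation T := (markedSpace Xi n).

HB.instance Definition _ := gen_eqMixin T.
HB.instance Definition _ := gen_choiceMixin T.

Lemma ms_iso_refl (A : T) : ms_iso A A.
Proof. by exists id; split => //; split => //; exists id. Qed.

Lemma ms_iso_sym (A B : T) : ms_iso A B -> ms_iso B A.
Proof.
move=> [rho [[[rho' K K'] rhod] rhoo rhom]]; exists rho'; split.
- by split; [exists rho | move=> x y; rewrite -rhod !K'].
- by move=> i; rewrite -rhoo K.
- by move=> x y; rewrite -rhom !K'.
Qed.

Lemma ms_iso_trans (A B C : T) : ms_iso A B -> ms_iso B C -> ms_iso A C.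
Proof.
move=> [f [[fb fd] fo fm]] [g [[gb gd] go gm]]; exists (g \o f); split => /=.
- by split => [|x y]; [exact: bij_comp | rewrite gd fd].
- by move=> i; rewrite fo go.
- by move=> x y; rewrite gm fm.
Qed.

Definition ms_isob : rel T := fun A B => `[< ms_iso A B >].

Lemma ms_isob_refl : reflexive ms_isob.
Proof. by move=> A; apply/asboolP; exact: ms_iso_refl. Qed.

Lemma ms_isob_sym : symmetric ms_isob.
Proof. by move=> A B; apply/asboolP/asboolP; exact: ms_iso_sym. Qed.

Lemma ms_isob_trans : transitive ms_isob.
Proof.
by move=> B A C /asboolP AB /asboolP BC; apply/asboolP; exact: ms_iso_trans BC.
Qed.

Canonical ms_equiv := EquivRel ms_isob ms_isob_refl ms_isob_sym ms_isob_trans.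

Definition ms_class : Type := {eq_quot ms_equiv}%qT.
HB.instance Definition _ := Choice.copy ms_class {eq_quot ms_equiv}%qT.
HB.instance Definition _ := Quotient.copy ms_class {eq_quot ms_equiv}%qT.

End quotient.

Let point_dist (_ _ : unit) : R := 0.
Let point_dist_eq0 x y : point_dist x y = 0 <-> x = y.
Proof. by case: x y => -[]. Qed.
Let point_dist_sym x y : point_dist x y = point_dist y x.
Proof. by []. Qed.
Let point_dist_triangle x y z :
  point_dist x z <= point_dist x y + point_dist y z.
Proof. by rewrite addr0. Qed.
Let point_finite_ball x r : finite_set [set y | point_dist x y <= r].
Proof. exact: finite_finset. Qed.

Definition point_space : discreteSpace R := DiscreteSpace point_dist_eq0
  point_dist_sym point_dist_triangle point_finite_ball.

HB.instance Definition _ (Xi : markType R) n := isPointed.Build (ms_class Xi n)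
  (\pi_(ms_class Xi n)%qT
    (@MarkedSpace Xi n point_space (fun=> tt) (fun _ _ => point))).

(* The injection of the ball into B is given by a total function, whose values
   outside the ball are irrelevant; hence an origin other than the first one
   has to be preserved only if it belongs to the ball. *)
Definition ms_close (Xi : markType R) n (e : R) (A B : markedSpace Xi n) :=
  let ball_A := [set x | ds_dist (ms_origin A ord0) x <= e^-1] in
  exists f : ms_space A -> ms_space B,
    [/\ set_inj ball_A f,
        forall i, f (ms_origin A i) = ms_origin B i &
        forall x y, ball_A x -> ball_A y ->
          `|ds_dist (f x) (f y) - ds_dist x y| <= e /\
          mdist (ms_mark B (f x) (f y)) (ms_mark A x y) <= e].

(* The infimum is taken in \bar R because inf set0 = 0 in R. *)
Definition class_dist (Xi : markType R) n (X Y : ms_class Xi n) : \bar R :=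
  Order.min 1%E (ereal_inf [set e%:E | e in
    [set e : R | [/\ 0 < e, ms_close e (repr X) (repr Y) &
                            ms_close e (repr Y) (repr X)]]]).

Definition class_open (Xi : markType R) n : set_system (ms_class Xi n) :=
  [set U | forall X, U X ->
    exists2 e : R, 0 < e & [set Y | (class_dist X Y < e%:E)%E] `<=` U].

Definition classes (Xi : markType R) n := g_sigma_algebraType (@class_open Xi n).

Definition mclass (Xi : markType R) (D : discreteSpace R) (o : D)
    (m : D -> D -> Xi) : classes Xi 0 :=
  \pi_(ms_class Xi 0)%qT (@MarkedSpace Xi 0 D (fun=> o) m).

Definition Dstar := classes (nomark R) 0.
Definition Dstarstar := classes (nomark R) 1.

Definition pclass2 (D : discreteSpace R) (o v : D) : Dstarstar :=
  \pi_(ms_class (nomark R) 1)%qT (@MarkedSpace (nomark R) 1 D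
    (fun i => if i == ord0 then o else v) (fun _ _ => tt)).

Definition space_of (X : Dstar) : discreteSpace R :=
  ms_space (repr (X : ms_class (nomark R) 0)).

Definition origin_of (X : Dstar) : space_of X :=
  ms_origin (repr (X : ms_class (nomark R) 0)) ord0.

End classes.

Section unimodular.
Context {R : realType} d {Om : measurableType d}.

Definition unimodular (P : probability Om R) (X : Om -> Dstar R) : Prop :=
  measurable_fun [set: Om] X /\
  forall g : Dstarstar R -> R,
    measurable_fun [set: Dstarstar R] g -> (forall Y, 0 <= g Y) ->
    (\int[P]_om (\esum_(v in [set: {classic space_of (X om)}])
        (g (pclass2 (origin_of (X om)) v))%:E) =
     \int[P]_om (\esum_(v in [set: {classic space_of (X om)}])
        (g (pclass2 v (origin_of (X om))))%:E))%E.

End unimodular.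

Record probSpace (R : realType) := ProbSpace {
  ps_display : measure_display ;
  ps_sort :> measurableType ps_display ;
  ps_prob : probability ps_sort R
}.
Arguments ps_prob {R} p : rename.

Section process.
Variable R : realType.

(* marking D Xi is Xi^(D * D) with the product of the Borel sigma-algebras. *)
Definition cylinders (D : discreteSpace R) (Xi : markType R) :
    set_system (D -> D -> Xi) :=
  [set A | exists x y (U : set Xi), open U /\ A = [set m | U (m x y)]].
Definition marking (D : discreteSpace R) (Xi : markType R) :=
  g_sigma_algebraType (@cylinders D Xi).

(* The process is only required to be defined on ep_dom, a class of discrete
   spaces invariant under isometries; the values of ep_val on other discrete
   spaces are junk. *)
Record eqProcess (Xi : markType R) := EqProcess {
  ep_dom : set (discreteSpace R) ;
  ep_space : discreteSpace R -> probSpace R ;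
  ep_val : forall D, ep_space D -> marking D Xi ;
  ep_dom_iso : forall (D1 D2 : discreteSpace R) (rho : D1 -> D2),
    is_isometry rho -> ep_dom D1 -> ep_dom D2 ;
  ep_dom_measurable : measurable [set X : Dstar R | ep_dom (space_of X)] ;
  ep_val_measurable : forall D, ep_dom D ->
    measurable_fun [set: ep_space D] (@ep_val D) ;
  ep_equivariant : forall (D1 D2 : discreteSpace R) (rho : D1 -> D2)
      (rhoV : D2 -> D1), is_isometry rho -> cancel rho rhoV ->
      cancel rhoV rho -> ep_dom D1 ->
    forall A : set (marking D2 Xi), measurable A ->
      ps_prob (ep_space D1)
        [set e | A (fun x y => ep_val e (rhoV x) (rhoV y))] =
      ps_prob (ep_space D2) [set e | A (ep_val e)] ;
  ep_law_measurable : forall A : set (classes Xi 0), measurable A ->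
    measurable_fun [set X : Dstar R | ep_dom (space_of X)]
      (fun X => ps_prob (ep_space (space_of X))
        [set e | A (mclass (origin_of X) (ep_val e))])
}.

Context d {Om : measurableType d}.
Variables (P : probability Om R) (X : Om -> Dstar R).
Variables (Xi : markType R) (Z : eqProcess Xi).

Definition process_on : Prop :=
  {ae P, forall om, ep_dom Z (space_of (X om))}.

(* [D, o; Z_D] is obtained by sampling [D, o] first and then Z_D, whence the
   iterated integrals and the iterated almost-sure quantifiers. *)
Definition process_E
    (f : forall D : discreteSpace R, D -> (D -> D -> Xi) -> \bar R) : \bar R :=
  (\int[P]_om \int[ps_prob (ep_space Z (space_of (X om)))]_e
     f _ (origin_of (X om)) (ep_val e))%E.

Definition process_as
    (Q : forall D : discreteSpace R, D -> (D -> D -> Xi) -> Prop) : Prop :=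
  {ae P, forall om, {ae ps_prob (ep_space Z (space_of (X om))), forall e,
     Q _ (origin_of (X om)) (ep_val e)}}.

Definition process_P
    (Q : forall D : discreteSpace R, D -> (D -> D -> Xi) -> Prop) : \bar R :=
  (\int[P]_om ps_prob (ep_space Z (space_of (X om)))
     [set e | Q _ (origin_of (X om)) (ep_val e)])%E.

End process.

Section hausdorff.
Variable R : realType.

(* Marks on points: m(v) := m(v, v). *)
Definition weight (D : discreteSpace R) (m : D -> D -> nneg_mark R) (v : D) : R :=
  sval (m v v).

Definition weight_set (D : discreteSpace R) (m : D -> D -> nneg_mark R)
    (A : set D) : \bar R :=
  (\esum_(v in (A : set {classic D})) (weight m v)%:E)%E.

Definition radius (D : discreteSpace R) (m : D -> D -> radius_mark R) (v : D) : R :=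
  sval (m v v).

(* powR has 0 `^ 0 = 1 whereas here 0 ^ 0 := 0 *)
Definition rpow (x a : R) : R := if x == 0 then 0 else x `^ a.

Context d {Om : measurableType d}.
Variables (P : probability Om R) (X : Om -> Dstar R).

Definition eq_covering (Z : eqProcess (radius_mark R)) : Prop :=
  process_on P X Z /\
  process_as P X Z (fun D _ m => forall u : D, exists v : D,
    nball (radius m v) v u).

Definition hausdorff_content (M alpha : R) : \bar R :=
  ereal_inf [set x | exists Z : eqProcess (radius_mark R),
    [/\ eq_covering Z,
        process_as P X Z (fun D _ m =>
          forall v : D, radius m v = 0 \/ M <= radius m v) &
        x = process_E P X Z (fun D o m => (rpow (radius m o) alpha)%:E)]].

(* sup set0 := 0, whereas ereal_sup set0 = -oo *)
Definition udimH : \bar R :=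
  Order.max 0%E (ereal_sup [set a%:E | a in
    [set a : R | 0 <= a /\ hausdorff_content 1 a = 0%E]]).

End hausdorff.

(* Main.v *)
(* Mass transport: given a covering with radii R independent of the weights w,
   let u send to v the mass w(v) / c when v lies in N_{R(u)}(u). A point o
   receives at least w(o) / c, because the balls cover, and sends at most
   w(N_{R(o)}(o)) / c <= R(o)^alpha. By unimodularity the two expectations agree.
   Only the conditional expectation of this mass given the unmarked space enters
   the mass transport principle, namely E[w(v)] P[v in N_{R(u)}(u)] / c; it is
   expressed by the tails of the one-point marks, E[w(v)] being approximated by
   finite sums of tails. *)

Require Import Defs.
From HB Require Import structures.
From mathcomp Require Import all_boot all_order all_algebra.
From mathcomp Require Import all_classical all_reals all_analysis measurable_realfun.
From mathcomp Require Import lra.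

Set Implicit Arguments.
Unset Strict Implicit.
Unset Printing Implicit Defensive.

Import Order.TTheory GRing.Theory Num.Theory.
Import numFieldNormedType.Exports.

Local Open Scope classical_set_scope.
Local Open Scope ring_scope.

Import HBNNSimple.

(* No measurability is needed: the integral of a nonnegative function is a
   supremum over the simple functions below it, and a simple function may be
   cut off on a null set without changing its integral. *)
Lemma ae_le_integral_nonmeas d (T : measurableType d) (R : realType)
    (mu : {measure set T -> \bar R}) (f g : T -> \bar R) :
  (forall x, 0 <= f x)%E -> (forall x, 0 <= g x)%E ->
  {ae mu, forall x, (f x <= g x)%E} ->
  (\int[mu]_x f x <= \int[mu]_x g x)%E.
Proof.
move=> f0 g0 [N [mN N0 fgN]]; rewrite !ge0_integralTE//.
apply: ge_ereal_sup => _ [h /= hf <-].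
have mNC : measurable (~` N) by exact: measurableC.
rewrite -integralT_nnsfun.
rewrite (@ge0_ae_eq_integral _ _ _ _ _ _ (EFin \o proj_nnsfun h mNC))//=; first last.
- exists N; split => // x /= /not_implyP[_ hx].
  apply: contrapT => Nx; apply: hx.
  by rewrite /= mindicE mem_set ?mulr1.
- by move=> x _; rewrite lee_fin mulr_ge0// fun_ge0.
- by move=> x _; rewrite lee_fin fun_ge0.
- by apply/measurable_EFinP; exact: measurable_funM.
- exact/measurable_EFinP.
have -> := integralT_nnsfun mu (proj_nnsfun h mNC).
apply: ereal_sup_ubound; exists (proj_nnsfun h mNC) => //= x.
rewrite /= mindicE; case: (pselect (N x)) => Nx.
  by rewrite memNset ?mulr0//=; apply.
rewrite mem_set ?mulr1//; apply: le_trans (hf x) _.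
by apply: contrapT => fgx; apply: Nx; exact: fgN.
Qed.

(** * Continuity and measurability on spaces of isomorphism classes *)

Section class_topology.
Variables (R : realType) (Xi : markType R).

Lemma ds_dist_ge0 (D : discreteSpace R) (x y : D) : 0 <= ds_dist x y.
Proof.
have := ds_dist_triangle x y x; rewrite (ds_dist_sym y x).
by rewrite (ds_dist_eq0 x x).2// -mulr2n pmulrn_lge0.
Qed.

Lemma ds_distxx (D : discreteSpace R) (x : D) : ds_dist x x = 0.
Proof. exact/ds_dist_eq0. Qed.

Lemma ms_iso_repr n (A : markedSpace Xi n) :
  ms_iso (repr (\pi_(ms_class Xi n)%qT A)) A.
Proof.
have /(@eqmodP _ (ms_equiv Xi n)) := reprK (\pi_(ms_class Xi n)%qT A).
by move/asboolP.
Qed.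

Lemma eq_pi_ms_iso n (A B : markedSpace Xi n) : ms_iso A B ->
  \pi_(ms_class Xi n)%qT A = \pi_(ms_class Xi n)%qT B.
Proof. by move=> AB; apply/(@eqmodP _ (ms_equiv Xi n))/asboolP. Qed.

(** Conjugating the injection by the isomorphisms allows the representatives chosen by [repr] to be
    exchanged for explicit spaces. *)
Lemma ms_close_iso n e (A A' B B' : markedSpace Xi n) :
  ms_iso A A' -> ms_iso B B' -> ms_close e A B -> ms_close e A' B'.
Proof.
move=> /ms_iso_sym[r [[rb rd] ro rm]] [s [[sb sd] so sm]] [f [fi fo fd]].
have br x : ds_dist (ms_origin A' ord0) x <= e^-1 ->
    ds_dist (ms_origin A ord0) (r x) <= e^-1 by rewrite -ro rd.
exists (s \o f \o r); split => /=.
- move=> x y; rewrite !inE /= => /br bx /br b_y /(bij_inj sb) /fi.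
  by rewrite !inE => /(_ bx b_y) /(bij_inj rb).
- by move=> i; rewrite ro fo so.
- by move=> x y /br bx /br b_y; rewrite sd sm -(rd x y) -(rm x y); exact: fd.
Qed.

Lemma class_dist_lt n (X Y : ms_class Xi n) (e : R) :
  e <= 1 -> (class_dist X Y < e%:E)%E ->
  exists d : R, [/\ 0 < d, d < e, ms_close d (repr X) (repr Y) &
    ms_close d (repr Y) (repr X)].
Proof.
move=> e1; rewrite /class_dist gt_min => /orP[|].
  by rewrite lte_fin ltNge e1.
by move=> /ereal_inf_lt[_ [d [d0 XY YX] <-]]; rewrite lte_fin; exists d.
Qed.

Lemma class_dist_le n (X Y : ms_class Xi n) (e : R) : 0 < e ->
  ms_close e (repr X) (repr Y) -> ms_close e (repr Y) (repr X) ->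
  (class_dist X Y <= e%:E)%E.
Proof.
move=> e0 XY YX; rewrite /class_dist ge_min; apply/orP; right.
by apply: ereal_inf_lbound; exists e.
Qed.

Definition odist n (i : 'I_n.+1) (A : markedSpace Xi n) : R :=
  ds_dist (ms_origin A ord0) (ms_origin A i).

Definition recenter n (i : 'I_n.+1) (A : markedSpace Xi n) : markedSpace Xi 0 :=
  @MarkedSpace R Xi 0 (ms_space A) (fun=> ms_origin A i) (@ms_mark R Xi n A).

(** The injection preserves all origins but controls distances only inside the ball of radius 1/e,
    whence the bound on [odist i A]. *)
Lemma ms_close_odist n (i : 'I_n.+1) (A B : markedSpace Xi n) (e : R) :
  0 < e -> odist i A <= e^-1 -> ms_close e A B ->
  `|odist i B - odist i A| <= e.
Proof.
move=> e0 Ae [f [fi fo fd]]; rewrite /odist -!fo.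
by apply: (fd _ _ _ _).1 => //=; rewrite ds_distxx invr_ge0 ltW.
Qed.

(** By the triangle inequality the ball of radius 1/e around the new origin lies in the ball of
    radius 1/d around the first one, so the same injection serves. *)
Lemma ms_close_recenter n (i : 'I_n.+1) (A B : markedSpace Xi n) (d e : R) :
  d <= e -> e^-1 + odist i A <= d^-1 ->
  ms_close d A B -> ms_close e (recenter i A) (recenter i B).
Proof.
move=> de Ad [f [fi fo fd]].
have sub x : ds_dist (ms_origin A i) x <= e^-1 ->
    ds_dist (ms_origin A ord0) x <= d^-1.
  move=> xe; apply: le_trans Ad; apply: le_trans (ds_dist_triangle _ (ms_origin A i) _) _.
  by rewrite addrC lerD2r.
exists f; split => /=.
- by move=> x y; rewrite !inE /= => /sub bx /sub b_y; apply: fi; rewrite inE.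
- by move=> _; rewrite fo.
- move=> x y /sub bx /sub b_y; have [h1 h2] := fd _ _ bx b_y.
  by split; [apply: le_trans h1 de|apply: le_trans h2 de].
Qed.

Lemma class_open_measurable n (U : set (classes Xi n)) :
  class_open U -> measurable U.
Proof. by move=> oU; apply: sub_sigma_algebra. Qed.

Lemma class_open_preimage n (T : Type) (f : classes Xi n -> T) (V : set T) :
  (forall X, V (f X) -> exists2 e : R, 0 < e &
    forall Y d, 0 < d -> d < e -> ms_close d (repr (X : ms_class Xi n)) (repr (Y : ms_class Xi n)) ->
      ms_close d (repr (Y : ms_class Xi n)) (repr (X : ms_class Xi n)) -> V (f Y)) ->
  measurable (f @^-1` V).
Proof.
move=> fV; apply: class_open_measurable => X /fV[e e0 XV].
(* Below 1 the truncation in [class_dist] is not felt, so a small distance yields injections in both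
   directions. *)
exists (Num.min e 1); first by rewrite lt_min e0 ltr01.
move=> Y /= /class_dist_lt; rewrite ge_min lexx orbT => /(_ isT)[d [d0]].
by rewrite lt_min => /andP[de _]; exact: XV.
Qed.

(** Open intervals generate the Borel sets of the line, and continuity makes their preimages open
    for the class distance. *)
Lemma measurable_class_realfun n (f : classes Xi n -> R) :
  (forall X (e : R), 0 < e -> exists2 d : R, 0 < d & forall Y d', 0 < d' -> d' < d ->
     ms_close d' (repr (X : ms_class Xi n)) (repr (Y : ms_class Xi n)) ->
     `|f Y - f X| < e) ->
  measurable_fun [set: classes Xi n] f.
Proof.
move=> fc; apply: (measurability _ (RGenOpens.measurableE R)).
move=> _ [_ [a [b ->]] <-]; rewrite setTI; apply: class_open_preimage => X /=.
rewrite in_itv/= => /andP[aX Xb].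
have [|d d0 fd] := fc X (Num.min (f X - a) (b - f X)).
  by rewrite lt_min !subr_gt0 aX.
exists d => // Y d' d'0 d'd /(fd _ _ d'0 d'd); rewrite lt_min !ltr_norml => XY _.
by rewrite in_itv/=; lra.
Qed.

Lemma measurable_odist n (i : 'I_n.+1) :
  measurable_fun [set: classes Xi n]
    (fun Y => odist i (repr (Y : ms_class Xi n))).
Proof.
apply: measurable_class_realfun => X e e0.
set L := odist i _; have L0 : 0 <= L by exact: ds_dist_ge0.
(* The second bound puts the i-th origin of [X] inside the ball of radius 1/d, where distances are
   controlled. *)
exists (Num.min e (L + 1)^-1).
  by rewrite lt_min e0 invr_gt0 ltr_wpDl.
move=> Y d d0; rewrite lt_min => /andP[de dL] XY.
apply: le_lt_trans de; apply: ms_close_odist XY => //.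
rewrite -/L; apply/ltW/(@lt_trans _ _ (L + 1)); first by rewrite ltrDl.
by rewrite -[ltLHS]invrK ltf_pV2 ?posrE ?invr_gt0 ?ltr_wpDl.
Qed.

(** For n = 1 this extracts the pointed class at either origin, so that functions on [Dstar] can be
    combined into a transport function. *)
Definition class_recenter n (i : 'I_n.+1) (Y : classes Xi n) : classes Xi 0 :=
  \pi_(ms_class Xi 0)%qT (recenter i (repr (Y : ms_class Xi n))).

Lemma measurable_class_recenter n (i : 'I_n.+1) :
  measurable_fun [set: classes Xi n] (class_recenter i).
Proof.
apply: (@measurability _ _ _ (classes Xi 0) _ _ (@class_open R Xi 0)) => //.
move=> _ [U oU <-]; rewrite setTI; apply: class_open_preimage => X /oU[e e0 eU].
have e20 : 0 < e / 2 by rewrite divr_gt0.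
set L := odist i (repr (X : ms_class Xi n)).
have L0 : 0 <= L by exact: ds_dist_ge0.
have K0 : 0 < (e / 2)^-1 + L + 1 by rewrite ltr_wpDl// addr_ge0// invr_ge0 ltW.
(* The bound 1 keeps the new origin of [Y] within L + 1 of its first origin; the last bound then
   lets both balls of radius 2/e around the new origins fit. Halving e gives the strict inequality
   at the end. *)
exists (Num.min (Num.min (e / 2) 1) ((e / 2)^-1 + L + 1)^-1).
  by rewrite !lt_min e20 ltr01 invr_gt0.
move=> Y d d0; rewrite !lt_min => /andP[/andP[de d1] dK] XY YX.
have {}dK : (e / 2)^-1 + L + 1 < d^-1.
  by rewrite -[ltLHS]invrK ltf_pV2 ?posrE ?invr_gt0.
have e2V : 0 < (e / 2)^-1 by rewrite invr_gt0.
have LL : odist i (repr (Y : ms_class Xi n)) <= L + 1.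
  have /ler_normlP[_] : `|odist i (repr (Y : ms_class Xi n)) - L| <= d.
    by apply: ms_close_odist XY => //; rewrite -/L; lra.
  by lra.
apply: eU; apply: (@le_lt_trans _ _ (e / 2)%:E); last by rewrite lte_fin; lra.
apply: class_dist_le => //.
- apply: ms_close_iso (ms_close_recenter (i := i) _ _ XY); rewrite -/L; try lra.
  + exact/ms_iso_sym/ms_iso_repr.
  + exact/ms_iso_sym/ms_iso_repr.
- apply: ms_close_iso (ms_close_recenter (i := i) _ _ YX); try lra.
  + exact/ms_iso_sym/ms_iso_repr.
  + exact/ms_iso_sym/ms_iso_repr.
Qed.

Lemma recenter_iso n (i : 'I_n.+1) (A B : markedSpace Xi n) :
  ms_iso A B -> ms_iso (recenter i A) (recenter i B).
Proof. by move=> [f [fb fo fm]]; exists f; split => // j /=; rewrite fo. Qed.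

Lemma odist_iso n (i : 'I_n.+1) (A B : markedSpace Xi n) :
  ms_iso A B -> odist i A = odist i B.
Proof. by move=> [f [[fb fd] fo fm]]; rewrite /odist -!fo fd. Qed.

Lemma class_recenter_pi n (i : 'I_n.+1) (A : markedSpace Xi n) :
  class_recenter i (\pi_(ms_class Xi n)%qT A) =
  \pi_(ms_class Xi 0)%qT (recenter i A).
Proof. exact/eq_pi_ms_iso/recenter_iso/ms_iso_repr. Qed.

End class_topology.

(** * Real marks and the tails of one-point marks *)

Section realmark.
Variables (R : realType) (S : pred R) (S0 : S 0).
Let T : markType R := realmark S0.

Definition rval (z : realmark S0) : R := sval z.

Definition class_mark (Y : classes T 0) : R :=
  let A := repr (Y : ms_class T 0) in
  rval (ms_mark (m := A) (ms_origin A ord0) (ms_origin A ord0)).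

Lemma class_mark_mclass (D : discreteSpace R) (o : D) (m : D -> D -> T) :
  class_mark (mclass o m) = rval (m o o).
Proof.
by rewrite /class_mark; have [f [_ fo fm]] := ms_iso_repr
  (@MarkedSpace R T 0 D (fun=> o) m); rewrite -fm !fo.
Qed.

(** The origin always lies in its own ball and is preserved, so d-close spaces have origin marks
    within d. *)
Lemma measurable_class_mark : measurable_fun [set: classes T 0] class_mark.
Proof.
apply: measurable_class_realfun => X e e0; exists e => // Y d d0 de.
move=> [f [_ fo fd]]; apply: le_lt_trans de.
rewrite /class_mark -!fo; apply: (fd _ _ _ _).2 => //=.
all: by rewrite ds_distxx invr_ge0 ltW.
Qed.

Lemma open_rval_lt (t : R) : open [set x : T | rval x < t].
Proof.
rewrite openE => x /= xt; apply/nbhs_ballP; exists (t - rval x) => /=.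
  by rewrite subr_gt0.
move=> y; rewrite ballEmdist /= => h.
have : `|rval x - rval y| < t - rval x by [].
by rewrite ltr_norml => /andP[]; lra.
Qed.

Lemma measurable_marking_ge (D : discreteSpace R) (x y : D) (t : R) :
  measurable [set m : marking D T | t <= rval (m x y)].
Proof.
rewrite (_ : [set _ | _] = ~` [set m : marking D T | rval (m x y) < t]).
  apply: measurableC; apply: sub_sigma_algebra; exists x, y.
  by exists [set z : T | rval z < t]; split => //; exact: open_rval_lt.
by apply/seteqP; split => m /=; rewrite leNgt => /negP.
Qed.

Variable Z : eqProcess T.

Definition tail (t : R) (D : discreteSpace R) (o : D) : \bar R :=
  ps_prob (ep_space Z D) [set e | t <= rval (ep_val e o o)].

Lemma measurable_mark_ge (D : discreteSpace R) (x y : D) (t : R) :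
  ep_dom Z D ->
  measurable [set e : ep_space Z D | t <= rval (ep_val e x y)].
Proof.
move=> /ep_val_measurable mZ.
by have := mZ measurableT _ (measurable_marking_ge x y t); rewrite setTI.
Qed.

Lemma tail_isometry t (D1 D2 : discreteSpace R) (rho : D1 -> D2) (o : D1) :
  is_isometry rho -> ep_dom Z D1 -> tail t (rho o) = tail t o.
Proof.
move=> rhoi domD; have [[rhoV K VK] _] := rhoi.
have := ep_equivariant rhoi K VK domD (measurable_marking_ge (rho o) (rho o) t).
by rewrite /= !K.
Qed.

(** The value 0 off the measurable domain of the process makes this a total function; on the domain
    [fine] only converts a probability to a real. *)
Definition class_tail (t : R) : Dstar R -> R :=
  fine \o ((fun X => tail t (origin_of X)) \_ [set X | ep_dom Z (space_of X)]).

Lemma measurable_class_tail t : measurable_fun [set: Dstar R] (class_tail t).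
Proof.
apply: measurableT_comp => //; apply/(measurable_restrictT _ _).1.
  exact: ep_dom_measurable.
have mA : measurable [set Y : classes T 0 | t <= class_mark Y].
  have := measurable_class_mark measurableT (measurable_itv `[t, +oo[).
  by rewrite setTI; congr measurable; apply/seteqP; split => Y /=; rewrite in_itv/= andbT.
have := @ep_law_measurable _ _ Z _ mA; congr measurable_fun; apply/funext => X.
by rewrite /tail; congr (ps_prob _ _); apply/funext => e /=; rewrite class_mark_mclass.
Qed.

(** The representative of the class is isometric to [D]; equivariance carries the tail over, and the
    domain is invariant under isometries. *)
Lemma class_tailE t (D : discreteSpace R) (o : D) (m : D -> D -> nomark R) :
  ep_dom Z D -> (class_tail t (mclass o m))%:E = tail t o.
Proof.
move=> domD; rewrite /class_tail /=.
have [f [fi fo _]] := ms_iso_sym (ms_iso_repr (@MarkedSpace R (nomark R) 0 D (fun=> o) m)).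
have dom' : ep_dom Z (space_of (mclass o m)) by exact: (ep_dom_iso fi).
rewrite patchT ?inE//; have <- := @tail_isometry t D _ f o fi domD.
have -> : f o = origin_of (mclass o m) := fo ord0.
rewrite fineK// /tail.
by rewrite fin_num_measure//; exact: measurable_mark_ge.
Qed.

Lemma class_tail_ge0 t X : 0 <= class_tail t X.
Proof. by rewrite /class_tail/= fine_ge0// /patch; case: ifP. Qed.

Lemma class_tail_off t X : ~ ep_dom Z (space_of X) -> class_tail t X = 0.
Proof. by move=> nX; rewrite /class_tail/= patchN// notin_setE. Qed.

End realmark.

(** * Tails with a variable threshold *)

Section tail_measurability.
Variables (R : realType) (S : pred R) (S0 : S 0).
Variable Z : eqProcess (realmark S0 : markType R).

Lemma class_tail_le (t q : R) X : q <= t ->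
  class_tail Z t X <= class_tail Z q X.
Proof.
move=> qt; have [domX|domX] := pselect (ep_dom Z (space_of X)); last first.
  by rewrite !class_tail_off.
rewrite /class_tail/= !patchT ?inE//.
rewrite fine_le ?fin_num_measure//; do ?exact: measurable_mark_ge.
apply: le_measure; rewrite ?inE; do ?exact: measurable_mark_ge.
by move=> e /=; exact: le_trans.
Qed.

(** Continuity from above: the events that the mark is at least t - 1/(n + 1) decrease to the event
    that it is at least t. *)
Lemma class_tail_left_continuous (t a : R) X : class_tail Z t X < a ->
  exists2 q : rat, ratr q < t & class_tail Z (ratr q) X < a.
Proof.
have ratlt (s : R) : s < t -> exists2 q : rat, s <= ratr q & ratr q < t.
  by move=> /rat_in_itvoo[q]; rewrite in_itv/= => /andP[/ltW]; exists q.
have [domX|domX] := pselect (ep_dom Z (space_of X)); last first.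
  rewrite class_tail_off// => a0.
  (* Off the domain the tail vanishes identically, so any rational below t will do. *)
  have [|q _ qt] := ratlt (t - 1); first by rewrite ltrBlDr ltrDl.
  by exists q => //; rewrite class_tail_off.
have tailE s : (class_tail Z s X)%:E = tail Z s (origin_of X).
  rewrite /class_tail/= patchT ?inE// fineK// fin_num_measure//.
  exact: measurable_mark_ge.
rewrite -lte_fin tailE => ta.
pose F n := [set e : ep_space Z (space_of X) |
  t - n.+1%:R^-1 <= rval (ep_val e (origin_of X) (origin_of X))].
have bigF : \bigcap_n F n =
    [set e | t <= rval (ep_val e (origin_of X) (origin_of X))].
  apply/seteqP; split => e /= h; last first.
    by move=> n _; apply: le_trans h; rewrite gerBl.
  apply/ler_addgt0Pr => d d0; rewrite -lerBlDr.
  have [n nd] := ltr_add_invr (y := 0 : R) (x := d) d0.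
  apply: le_trans (h n I); rewrite lerD2l lerN2 ltW//.
  by rewrite add0r in nd.
have mF n : measurable (F n) by exact: measurable_mark_ge.
have : (ps_prob (ep_space Z (space_of X)) \o F) n @[n --> \oo] -->
    tail Z t (origin_of X).
  rewrite /tail -bigF; apply: nonincreasing_cvg_mu => //.
  - by rewrite (le_lt_trans (probability_le1 _ (mF 0%N)))// ltry.
  - exact: bigcapT_measurable.
  - move=> n m nm; apply/subsetPset => e /=; apply: le_trans.
    by rewrite lerD2l lerN2 lef_pV2 ?posrE// ler_nat.
move=> cvF; have [N Na] : exists N, (ps_prob (ep_space Z (space_of X)) (F N) < a%:E)%E.
  apply: contrapT => /forallNP aF; move: ta; apply/negP; rewrite -leNgt.
  apply: (cvge_to_ge cvF); apply: nearW => n /=.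
  by rewrite leNgt; apply/negP; exact: aF.
have [|q sq qt] := ratlt (t - N.+1%:R^-1).
  by rewrite ltrBlDr ltrDl.
exists q => //; rewrite -lte_fin; apply: le_lt_trans Na.
by rewrite -/(tail Z (t - N.+1%:R^-1) (origin_of X)) -tailE lee_fin class_tail_le.
Qed.

(* As the tail is nonincreasing and left-continuous in t, it is < a at t = f y
   iff it is < a at some rational q < f y. *)
Lemma measurable_class_tail_comp d (T : measurableType d) (f : T -> R)
    (h : T -> Dstar R) :
  measurable_fun [set: T] f -> measurable_fun [set: T] h ->
  measurable_fun [set: T] (fun y => class_tail Z (f y) (h y)).
Proof.
move=> mf mh; apply: (measurability _ (RGenInftyO.measurableE R)).
move=> _ [_ [a ->] <-]; rewrite setTI.
rewrite (_ : _ @^-1` _ = \bigcup_(q : rat)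
    ((f @^-1` `]ratr q, +oo[) `&`
     ((fun y => class_tail Z (ratr q) (h y)) @^-1` `]-oo, a[))).
  apply: bigcupT_measurable_rat => q; apply: measurableI.
    by have := mf measurableT _ (measurable_itv `]ratr q, +oo[); rewrite setTI.
  have mq := measurableT_comp (measurable_class_tail Z (ratr q)) mh.
  by have := mq measurableT _ (measurable_itv `]-oo, a[); rewrite setTI.
apply/seteqP; split => y /=; rewrite ?in_itv/=.
  move=> /class_tail_left_continuous[q qf qa]; exists q => //=.
  by rewrite !in_itv/= qf.
move=> [q _ []]; rewrite /= !in_itv/= andbT => qf; apply: le_lt_trans.
by apply: class_tail_le; exact: ltW.
Qed.

End tail_measurability.

(** * Staircase approximation from below *)

Section step.
Variable R : realType.

(* eps * floor(x / eps), capped at eps * n *)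
Definition step (eps : R) (n : nat) (x : R) : R :=
  \sum_(k < n) eps * (eps * k.+1%:R <= x)%R%:R.

Lemma step_ge0 eps n x : 0 <= eps -> 0 <= step eps n x.
Proof. by move=> e0; apply: sumr_ge0 => k _; rewrite mulr_ge0. Qed.

Lemma step_le_max eps n x : 0 <= eps -> step eps n x <= eps * n%:R.
Proof.
move=> e0; apply: (@le_trans _ _ (\sum_(k < n) eps)).
  by apply: ler_sum => k _; rewrite ler_piMr// lern1 leq_b1.
by rewrite sumr_const card_ord mulr_natr.
Qed.

(** Induction on n: either x has reached the next cap, which bounds the whole sum, or the new term
    vanishes. *)
Lemma step_le eps n x : 0 <= eps -> 0 <= x -> step eps n x <= x.
Proof.
move=> e0 x0; elim: n => [|n IH]; first by rewrite /step big_ord0.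
have [xn|nx] := leP (eps * n.+1%:R) x.
  exact: le_trans (step_le_max _ _ e0) xn.
by rewrite /step big_ord_recr/= (lt_geF nx) mulr0 addr0.
Qed.

Lemma step_max eps n x : 0 <= eps -> eps * n%:R <= x -> step eps n x = eps * n%:R.
Proof.
move=> e0 nx; rewrite /step (eq_bigr (fun=> eps)).
  by rewrite sumr_const card_ord mulr_natr.
move=> k _; rewrite (le_trans _ nx) ?mulr1//.
by rewrite ler_wpM2l// ler_nat.
Qed.

(** Induction on n: if x exceeds the previous cap, the staircase has reached that cap, and x is at
    most one step higher. *)
Lemma le_step eps n x : 0 <= eps -> x <= eps * n%:R -> x <= step eps n x + eps.
Proof.
move=> e0; elim: n => [|n IH] xn.
  by rewrite /step big_ord0 add0r (le_trans xn)// mulr0.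
have ss : step eps n x <= step eps n.+1 x.
  by rewrite /step big_ord_recr/= lerDl mulr_ge0.
have [/IH h|nx] := leP x (eps * n%:R); first by rewrite (le_trans h)// lerD2r.
apply: le_trans xn _; rewrite -natr1 mulrDr mulr1 lerD2r.
by rewrite -(step_max e0 (ltW nx)).
Qed.

End step.

(** * Classes of unmarked spaces *)

Section uclass.
Variable R : realType.

Definition uclass (D : discreteSpace R) (v : D) : Dstar R :=
  mclass v (fun _ _ => tt : nomark R).

Lemma uclass_origin (X : Dstar R) : uclass (origin_of X) = X.
Proof.
rewrite -[RHS](@reprK _ (ms_class (nomark R) 0)); apply: eq_pi_ms_iso.
exists id; split=> //; first by split => //; exists id.
- by move=> i; rewrite /= /origin_of (ord1 i).
- by move=> x y /=; case: (ms_mark _ _).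
Qed.

Lemma recenter_pclass2 (D : discreteSpace R) (o v : D) (i : 'I_2) :
  class_recenter i (pclass2 o v) = uclass (if i == ord0 then o else v).
Proof. exact: class_recenter_pi. Qed.

Lemma odist_pclass2 (D : discreteSpace R) (o v : D) :
  odist ord_max (repr (pclass2 o v : ms_class (nomark R) 1)) = ds_dist o v.
Proof. exact: (odist_iso ord_max (ms_iso_repr _)). Qed.

End uclass.

(** * Expected discretized marks *)

Section step_mass.
Variables (R : realType) (S : pred R) (S0 : S 0).
Variable Z : eqProcess (realmark S0 : markType R).
Variables (eps : R) (n : nat).
Hypothesis eps0 : 0 <= eps.

(** On the domain this is the expectation of [step eps n] of the mark at the origin
    ([integral_step]); as a finite sum of tails it is measurable in the class. *)
Definition step_mass (X : Dstar R) : R :=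
  \sum_(k < n) eps * class_tail Z (eps * k.+1%:R) X.

Lemma measurable_step_mass : measurable_fun [set: Dstar R] step_mass.
Proof.
apply: measurable_sum => k; apply: measurable_funM => //.
exact: measurable_class_tail.
Qed.

Lemma step_mass_ge0 X : 0 <= step_mass X.
Proof. by apply: sumr_ge0 => k _; rewrite mulr_ge0// class_tail_ge0. Qed.

Variables (D : discreteSpace R) (domD : ep_dom Z D) (v : D).

Lemma step_indic (e : ep_space Z D) :
  step eps n (rval (ep_val e v v)) =
  \sum_(k < n) eps * \1_[set e : ep_space Z D | eps * k.+1%:R <= rval (ep_val e v v)] e.
Proof.
apply: eq_bigr => k _; congr (_ * _); rewrite indicE.
by congr (nat_of_bool _)%:R; apply/idP/idP; rewrite inE.
Qed.

Lemma measurable_step : measurable_fun [set: ep_space Z D]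
  (fun e => step eps n (rval (ep_val e v v))).
Proof.
rewrite (funext step_indic); apply: measurable_sum => k.
by apply: measurable_funM => //; apply: measurable_indic; exact: measurable_mark_ge.
Qed.

Lemma integral_step :
  (\int[ps_prob (ep_space Z D)]_e (step eps n (rval (ep_val e v v)))%:E =
   (step_mass (uclass v))%:E)%E.
Proof.
under eq_integral do rewrite step_indic -sumEFin.
rewrite ge0_integral_sum//; first last.
- by move=> k e _; rewrite lee_fin mulr_ge0.
- move=> k; apply/measurable_EFinP; apply: measurable_funM => //.
  by apply: measurable_indic; exact: measurable_mark_ge.
rewrite -sumEFin; apply: eq_bigr => k _.
have mk := measurable_mark_ge v v (eps * k.+1%:R) domD.
under eq_integral do rewrite EFinM.
rewrite ge0_integralZl_EFin//; last first.
  by apply/measurable_EFinP; exact: measurable_indic.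
by rewrite integral_indic// setIT EFinM class_tailE.
Qed.

End step_mass.

(** * Mass sent and received in a fixed space *)

Section estimates.
Variable R : realType.
Variables (w : eqProcess (nneg_mark R)) (Z : eqProcess (radius_mark R)).
Variables (alpha c M eps : R) (n : nat).
Hypothesis (c0 : 0 < c) (M0 : 0 < M) (eps0 : 0 <= eps).
Variable D : discreteSpace R.
Hypotheses (domw : ep_dom w D) (domZ : ep_dom Z D).

Lemma weight_ge0 (m : D -> D -> nneg_mark R) (v : D) : 0 <= weight m v.
Proof. exact: (svalP (m v v)). Qed.

Lemma radius_ge1 (m : D -> D -> radius_mark R) (v : D) :
  0 < Defs.radius m v -> 1 <= Defs.radius m v.
Proof. by rewrite /Defs.radius; have /orP[/eqP ->|//] := svalP (m v v); rewrite ltxx. Qed.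

(** The finite sum passes inside the expectation, where it is at most the weight of the ball because
    [step] rounds down. *)
Lemma sum_step_mass_le (o : D) (r : R) (F : set {classic D}) :
  finite_set F -> F `<=` (nball r o : set {classic D}) -> 0 <= r ->
  {ae ps_prob (ep_space w D), forall e,
    (weight_set (ep_val e) (nball r o) <= (c * r `^ alpha)%:E)%E} ->
  \sum_(v \in F) step_mass w eps n (uclass (v : D)) <= c * r `^ alpha.
Proof.
move=> finF Fr r0 wr; rewrite -lee_fin -fsumEFin//.
under eq_fsbigr do rewrite -integral_step//.
rewrite -ge0_integral_fsum//; first last.
- by move=> v e _; rewrite lee_fin step_ge0.
- by move=> v; apply/measurable_EFinP; exact: measurable_step.
apply: (@le_trans _ _ (\int[ps_prob (ep_space w D)]_e (c * r `^ alpha)%:E)%E); last first.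
  by rewrite integral_cst// [X in (_ * X)%E]probability_setT mule1.
apply: ae_le_integral_nonmeas.
- by move=> e; apply: fsume_ge0 => v _; rewrite lee_fin step_ge0.
- by move=> e; rewrite lee_fin mulr_ge0 ?powR_ge0 ?ltW.
apply: filterS wr => e; apply: le_trans.
apply: esum_ge; exists F; first by split.
apply: lee_fsum => // v _; rewrite lee_fin.
by apply: step_le => //; exact: (weight_ge0 (ep_val e)).
Qed.

(** Nonzero radii are at least 1, so the maximum with 1 turns membership in a ball into a single
    threshold on the radius, and excludes radius 0 even when u = v. *)
Lemma radius_max_ge (m : D -> D -> radius_mark R) (u v : D) :
  nball (Defs.radius m v) v u -> Num.max 1 (ds_dist v u) <= Defs.radius m v.
Proof. by move=> [/radius_ge1 r1 vu]; rewrite ge_max r1. Qed.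

(** The weights being already averaged, the sum is an expectation over the radius at [o] alone. For
    each value r of it, the points reached form the ball of radius r, to which [sum_step_mass_le]
    applies. *)
Lemma mass_sent_le (o : D) :
  {ae ps_prob (ep_space w D), forall e, forall r, M <= r ->
    (weight_set (ep_val e) (nball r o) <= (c * r `^ alpha)%:E)%E} ->
  {ae ps_prob (ep_space Z D), forall e, forall v : D,
    Defs.radius (ep_val e) v = 0 \/ M <= Defs.radius (ep_val e) v} ->
  (\esum_(v in [set: {classic D}])
    (c^-1 * step_mass w eps n (uclass (v : D)) *
      class_tail Z (Num.max 1 (ds_dist o v)) (uclass o))%:E <=
   \int[ps_prob (ep_space Z D)]_e (rpow (Defs.radius (ep_val e) o) alpha)%:E)%E.
Proof.
move=> wball rad; apply: ge_ereal_sup => _ [F [finF _] <-].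
pose a (v : {classic D}) := c^-1 * step_mass w eps n (uclass (v : D)).
have a_ge0 v : 0 <= a v by rewrite mulr_ge0 ?step_mass_ge0// invr_ge0 ltW.
pose A (v : {classic D}) := [set e : ep_space Z D |
  Num.max 1 (ds_dist o v) <= rval (ep_val e o o)].
have mA v : measurable (A v) by exact: measurable_mark_ge.
have aE v : (a v * class_tail Z (Num.max 1 (ds_dist o v)) (uclass o))%:E =
    (\int[ps_prob (ep_space Z D)]_e (a v * \1_(A v) e)%:E)%E.
  under [RHS]eq_integral do rewrite EFinM.
  rewrite ge0_integralZl_EFin//; last first.
    by apply/measurable_EFinP; exact: measurable_indic.
  by rewrite integral_indic// setIT EFinM class_tailE.
under eq_fsbigr do rewrite aE.
rewrite -ge0_integral_fsum//; first last.
- by move=> v e _; rewrite lee_fin mulr_ge0.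
- by move=> v; apply/measurable_EFinP; exact: measurable_funM.
apply: ae_le_integral_nonmeas.
- by move=> e; apply: fsume_ge0 => v _; rewrite lee_fin mulr_ge0.
- by move=> e; rewrite lee_fin /rpow; case: ifP => // _; exact: powR_ge0.
apply: filterS rad => e /(_ o); set r := Defs.radius _ _.
pose Br : set {classic D} := [set v | Num.max 1 (ds_dist o v) <= r].
have -> : (\sum_(v \in F) (a v * \1_(A v) e)%:E =
    \sum_(v \in F) (if v \in Br then (a v)%:E else 0))%E.
  apply: eq_fsbigr => v _; rewrite indicE.
  have -> : (e \in A v) = (v \in Br).
    by apply/idP/idP; rewrite !inE.
  by case: ifP => _; rewrite ?mulr1 ?mulr0.
(* Radius 0 reaches no point, since the threshold is at least 1; otherwise r is at least M and the
   weight bound is available. *)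
rewrite -fsbig_mkcondr; case=> [r0|Mr].
  rewrite fsbig1 ?lee_fin /rpow; first by case: ifP => // _; exact: powR_ge0.
  by move=> v [_]; rewrite /Br /= r0 leNgt lt_max ltr01.
have r0 : 0 < r by exact: lt_le_trans Mr.
rewrite fsumEFin; last exact: finite_setIl.
rewrite lee_fin /rpow gt_eqF// /a -mulr_fsumr -ler_pdivlMl ?invr_gt0// invrK.
apply: (sum_step_mass_le (o := o)) => //.
- exact: finite_setIl.
- by move=> v [_]; rewrite /Br /= ge_max => /andP[_]; split.
- exact: ltW.
- by apply: filterS wball => e'; exact.
Qed.

(** Almost surely some ball covers [o]. The union bound is applied to the finitely many centers
    within distance k of [o], and then k tends to infinity. *)
Lemma mass_received_ge (o : D) (a : R) : 0 <= a ->
  {ae ps_prob (ep_space Z D), forall e, forall u : D, exists v : D,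
    nball (Defs.radius (ep_val e) v) v u} ->
  (a%:E <= \esum_(v in [set: {classic D}])
    (a * class_tail Z (Num.max 1 (ds_dist v o)) (uclass (v : D)))%:E)%E.
Proof.
move=> a0 cov; set mu := ps_prob (ep_space Z D).
pose A (v : {classic D}) := [set e : ep_space Z D |
  Num.max 1 (ds_dist v o) <= rval (ep_val e (v : D) (v : D))].
have mA v : measurable (A v) by exact: measurable_mark_ge.
pose B k : set {classic D} := [set v | ds_dist o v <= k%:R].
have finB k : finite_set (B k) by exact: ds_finite_ball.
pose U k := \bigcup_(v in B k) A v.
have mU k : measurable (U k) by exact: fin_bigcup_measurable.
have mUU : measurable (\bigcup_k U k) by exact: bigcupT_measurable.
have muU : mu (\bigcup_k U k) = 1%E.
  apply/eqP; rewrite eq_le probability_le1//=.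
  rewrite -(probability_setT mu) -(setUv (\bigcup_k U k)) measureU//; last 2 first.
  - exact: measurableC.
  - exact: setICr.
  rewrite [X in (_ + X)%E](_ : _ = 0%E) ?adde0//.
  apply/negligibleP; first exact: measurableC.
  apply: negligibleS cov => e /= nU ecov; apply: nU.
  have [v /radius_max_ge ov] := ecov o.
  (* The center of a ball covering [o] is at finite distance, hence in some [B k]. *)
  exists (Num.truncn (ds_dist o v)).+1 => //; exists v => //.
  exact/ltW/truncnS_gt.
have cvU : (mu \o U) k @[k --> \oo] --> 1%E.
  rewrite -muU; apply: nondecreasing_cvg_mu => //.
  move=> k l kl; apply/subsetPset; apply: bigcup_subset => v /=.
  by move=> /le_trans; apply; rewrite ler_nat.
have {}cvU := cvgeZl (isT : a%:E \is a fin_num) cvU.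
rewrite mule1 in cvU; apply: (cvge_to_le cvU); apply: nearW => k.
apply: esum_ge; exists (B k); first by split.
have -> : (\sum_(v \in B k)
      (a * class_tail Z (Num.max 1 (ds_dist v o)) (uclass (v : D)))%:E =
    \sum_(v \in B k) (a%:E * mu (A v)))%E.
  by apply: eq_fsbigr => v _; rewrite EFinM class_tailE.
rewrite -ge0_mule_fsumr//; apply: lee_pmul => //.
exact: content_sub_fsum.
Qed.

End estimates.

(** * The mass transport principle and the lower bound on the content *)

Section mass_transport.
Context {R : realType} d {Om : measurableType d}.
Variables (P : probability Om R) (X : Om -> Dstar R).
Hypothesis hX : unimodular P X.
Variables (alpha c M : R) (w : eqProcess (nneg_mark R)).
Hypotheses (c0 : 0 < c) (M0 : 0 < M) (hw : process_on P X w).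
Hypothesis hball : process_as P X w (fun D o m => forall r : R, M <= r ->
  (weight_set m (nball r o) <= (c * r `^ alpha)%:E)%E).

(* The mass sent by the first origin to the second one. *)
Let g (Z : eqProcess (radius_mark R)) (eps : R) (n : nat) (Y : Dstarstar R) : R :=
  c^-1 * step_mass w eps n (class_recenter ord_max Y) *
  class_tail Z (Num.max 1 (odist ord_max (repr (Y : ms_class (nomark R) 1))))
    (class_recenter ord0 Y).

Let gE Z eps n (D : discreteSpace R) (o v : D) : g Z eps n (pclass2 o v) =
  c^-1 * step_mass w eps n (uclass v) *
  class_tail Z (Num.max 1 (ds_dist o v)) (uclass o).
Proof. by rewrite /g !recenter_pclass2 odist_pclass2. Qed.

Let measurable_g Z eps n : measurable_fun [set: Dstarstar R] (g Z eps n).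
Proof.
apply: measurable_funM.
  apply: measurable_funM => //.
  apply: (measurableT_comp (measurable_step_mass _ _ _)).
  exact: measurable_class_recenter.
(* The threshold varies with [Y], so measurability at each fixed threshold would not suffice. *)
apply: measurable_class_tail_comp; last exact: measurable_class_recenter.
by apply: measurable_maxr => //; exact: measurable_odist.
Qed.

(** The slack in the bound is the price of replacing the weight by its staircase approximation. *)
Lemma process_weight_le (Z : eqProcess (radius_mark R)) (eps : R) :
  eq_covering P X Z ->
  process_as P X Z (fun D _ m => forall v : D,
    Defs.radius m v = 0 \/ M <= Defs.radius m v) ->
  0 < eps ->
  ((c^-1)%:E * process_E P X w (fun D o m => (weight m o)%:E) <=
   process_E P X Z (fun D o m => (rpow (Defs.radius m o) alpha)%:E) +
   (c^-1 * eps)%:E)%E.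
Proof.
move=> [hZ cov] rad eps0; have eps_ge0 := ltW eps0.
have cV0 : 0 <= c^-1 by rewrite invr_ge0 ltW.
(* w(o) <= w(N_M(o)) <= c M^alpha, so that the cap eps * n is harmless *)
pose n := (Num.truncn (c * M `^ alpha / eps)).+1.
have nM : c * M `^ alpha <= eps * n%:R.
  by rewrite [leRHS]mulrC -ler_pdivrMr// ltW// truncnS_gt.
have mX : measurable_fun [set: Om] (fun om => step_mass w eps n (X om)).
  exact: measurableT_comp (measurable_step_mass _ _ _) hX.1.
have wE : (process_E P X w (fun D o m => (weight m o)%:E) <=
    \int[P]_om (step_mass w eps n (X om))%:E + eps%:E)%E.
  have -> : (\int[P]_om (step_mass w eps n (X om))%:E + eps%:E =
      \int[P]_om ((step_mass w eps n (X om))%:E + eps%:E))%E.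
    rewrite ge0_integralD//.
    - by rewrite integral_cst// [X in (_ + _ * X)%E]probability_setT mule1.
    - by move=> om _; rewrite lee_fin step_mass_ge0.
    - exact/measurable_EFinP.
  apply: ae_le_integral_nonmeas.
  - by move=> om; apply: integral_ge0 => e _; rewrite lee_fin weight_ge0.
  - by move=> om; rewrite lee_fin addr_ge0// step_mass_ge0.
  apply: filterS2 hw hball => om domw wball.
  (* Writing the sampled class as the class of its own origin exposes a concrete space, on which the
     process can be integrated. *)
  rewrite -[X in step_mass _ _ _ X]uclass_origin -integral_step//.
  have -> : (\int[ps_prob (ep_space w (space_of (X om)))]_e
        (step eps n (rval (ep_val e (origin_of (X om)) (origin_of (X om)))))%:E +
      eps%:E = \int[ps_prob (ep_space w (space_of (X om)))]_e
        ((step eps n (rval (ep_val e (origin_of (X om)) (origin_of (X om)))))%:E +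
      eps%:E))%E.
    rewrite ge0_integralD//.
    - by rewrite integral_cst// [X in (_ + _ * X)%E]probability_setT mule1.
    - by move=> e _; rewrite lee_fin step_ge0.
    - by apply/measurable_EFinP; exact: measurable_step.
  apply: ae_le_integral_nonmeas.
  - by move=> e; rewrite lee_fin weight_ge0.
  - by move=> e; rewrite lee_fin addr_ge0// step_ge0.
  apply: filterS wball => e /(_ M (lexx _)) wM.
  rewrite -EFinD lee_fin; apply: le_step => //; apply: le_trans nM.
  rewrite -lee_fin; apply: le_trans wM.
  apply: esum_ge; exists [set origin_of (X om) : {classic space_of (X om)}].
    by split => // _ ->; split => //; rewrite ds_distxx ltW.
  by rewrite fsbig_set1.
apply: (le_trans (lee_wpmul2l _ wE)); first by rewrite lee_fin.
rewrite muleDr//; last first.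
  apply: ge0_adde_def; rewrite inE ?lee_fin//.
  by apply: integral_ge0 => om _; rewrite lee_fin step_mass_ge0.
rewrite EFinM leeD2r// -ge0_integralZl_EFin//; last 2 first.
- by move=> om _; rewrite lee_fin step_mass_ge0.
- exact/measurable_EFinP.
have g0 Y : 0 <= g Z eps n Y.
  by rewrite !mulr_ge0// ?step_mass_ge0// class_tail_ge0.
apply: (@le_trans _ _ (\int[P]_om (\esum_(v in [set: {classic space_of (X om)}])
    (g Z eps n (pclass2 (v : space_of (X om)) (origin_of (X om))))%:E))%E).
  apply: ae_le_integral_nonmeas.
  - by move=> om; rewrite -EFinM lee_fin mulr_ge0// step_mass_ge0.
  - by move=> om; apply: esum_ge0 => v _; rewrite lee_fin.
  apply: filterS2 hZ cov => om domZ cov.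
  under eq_esum do rewrite gE.
  rewrite -EFinM -[X in step_mass _ _ _ X]uclass_origin.
  by apply: mass_received_ge => //; rewrite mulr_ge0// step_mass_ge0.
(* Unimodularity exchanges the mass received by the origin for the mass it sends. *)
rewrite -hX.2//.
apply: ae_le_integral_nonmeas.
- by move=> om; apply: esum_ge0 => v _; rewrite lee_fin.
- move=> om; apply: integral_ge0 => e _; rewrite lee_fin /rpow.
  by case: ifP => // _; exact: powR_ge0.
apply: filterS2 (filterI hw hball) (filterI hZ rad) => om [domw wball] [domZ {}rad].
under eq_esum do rewrite gE.
exact: (mass_sent_le (M := M)).
Qed.

Lemma hausdorff_content_ge :
  ((c^-1)%:E * process_E P X w (fun D o m => (weight m o)%:E) <=
    hausdorff_content P X M alpha)%E.
Proof.
apply: le_ereal_inf_tmp => _ [Z [cov rad ->]].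
apply/lee_addgt0Pr => e e0.
(* With eps = c e the slack is exactly e. *)
have := process_weight_le cov rad (mulr_gt0 c0 e0).
by rewrite mulKf ?gt_eqF.
Qed.

End mass_transport.

(** * From the content to the dimension *)

Section dimension.
Context {R : realType} d {Om : measurableType d}.
Variables (P : probability Om R) (X : Om -> Dstar R).
Hypothesis mX : measurable_fun [set: Om] X.

(** Every admissible radius is 0 or at least 1, and on such values the power is nondecreasing in the
    exponent. *)
Lemma hausdorff_content_le (a b : R) : a <= b ->
  (hausdorff_content P X 1 a <= hausdorff_content P X 1 b)%E.
Proof.
move=> ab; apply: le_ereal_inf_tmp => _ [Z [cov rad ->]].
apply: (@le_trans _ _ (process_E P X Z (fun D o m => (rpow (Defs.radius m o) a)%:E))).
  by apply: ereal_inf_lbound; exists Z.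
have rpow_ge0 x e : (0 <= (@rpow R x e)%:E)%E.
  by rewrite lee_fin /rpow; case: ifP => // _; exact: powR_ge0.
apply: ae_le_integral_nonmeas => [om|om|].
- by apply: integral_ge0.
- by apply: integral_ge0.
apply: filterS rad => om rad; apply: ae_le_integral_nonmeas => //.
apply: filterS rad => e /(_ (origin_of (X om))); rewrite lee_fin /rpow.
move=> [->|r1]; first by rewrite eqxx.
by rewrite gt_eqF ?(lt_le_trans ltr01)// ler_powR.
Qed.

(** By contraposition: if the mean vanishes, Markov's inequality makes every tail at 1/(n + 1)
    vanish almost surely, and these countably many events exhaust positivity of the weight. *)
Lemma process_weight_gt0 (w : eqProcess (nneg_mark R)) :
  process_on P X w ->
  (0 < process_P P X w (fun D o m => (0 < weight m o)%R))%E ->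
  (0 < process_E P X w (fun D o m => (weight m o)%:E))%E.
Proof.
move=> hw; apply: contraTT; rewrite -!leNgt => E0.
pose t n (om : Om) := class_tail w n.+1%:R^-1 (X om).
have mt n : measurable_fun [set: Om] (t n).
  exact: measurableT_comp (measurable_class_tail _ _) mX.
have tE n om : ep_dom w (space_of (X om)) ->
    (t n om)%:E = tail w n.+1%:R^-1 (origin_of (X om)).
  by move=> domw; rewrite /t -[in LHS](uclass_origin (X om)) class_tailE.
have t_ge0 n om : (0 <= (t n om)%:E)%E by rewrite lee_fin class_tail_ge0.
have t0 n : {ae P, forall om, t n om = 0}.
  (* Markov's inequality: 1/(n + 1) times the indicator of the tail event is at most the weight. *)
  have : (\int[P]_om (n.+1%:R^-1%:E * (t n om)%:E) = 0)%E.
    apply/eqP; rewrite eq_le; apply/andP; split; last first.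
      by apply: integral_ge0 => om _; rewrite mule_ge0// lee_fin invr_ge0.
    apply: le_trans E0; apply: ae_le_integral_nonmeas.
    - by move=> om; rewrite mule_ge0// lee_fin invr_ge0.
    - by move=> om; apply: integral_ge0 => e _; rewrite lee_fin weight_ge0.
    apply: filterS hw => om domw; rewrite tE//.
    have mA := measurable_mark_ge (origin_of (X om)) (origin_of (X om)) n.+1%:R^-1 domw.
    rewrite /tail -[X in ps_prob _ X]setIT -integral_indic//.
    rewrite -ge0_integralZl_EFin//; last first.
      by apply/measurable_EFinP; exact: measurable_indic.
    apply: ae_le_integral_nonmeas.
    - by move=> e; rewrite -EFinM lee_fin mulr_ge0.
    - by move=> e; rewrite lee_fin weight_ge0.
    apply: aeW => e; rewrite -EFinM lee_fin indicE.
    have [|_] := boolP (e \in _); last by rewrite mulr0 weight_ge0.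
    by rewrite inE mulr1.
  have mkt : measurable_fun [set: Om] (fun om => n.+1%:R^-1%:E * (t n om)%:E)%E.
    by apply: measurable_funeM; exact/measurable_EFinP.
  move=> int0; have /(ae_eq_integral_abs P measurableT mkt) :
      (\int[P]_om `|n.+1%:R^-1%:E * (t n om)%:E| = 0)%E.
    rewrite -[RHS]int0; apply: eq_integral => om _.
    by rewrite gee0_abs// mule_ge0// lee_fin invr_ge0.
  apply: filterS => om /(_ I)/eqP; rewrite -EFinM /= eqe mulf_eq0 invr_eq0.
  by rewrite pnatr_eq0 => /eqP.
rewrite -(integral0 P [set: Om]); apply: ae_le_integral_nonmeas => //.
apply: filterS2 hw (ae_foralln t0) => om domw {}t0.
set mu := ps_prob _; set o := origin_of _.
pose A n := [set e : ep_space w (space_of (X om)) |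
  n.+1%:R^-1 <= rval (ep_val e o o)].
have mA n : measurable (A n) by exact: measurable_mark_ge.
rewrite (_ : [set e | _] = \bigcup_n A n).
  rewrite measure_negligible//; first exact: bigcupT_measurable.
  apply: negligible_bigcup => n; apply/negligibleP => //.
  by have := tE n om domw; rewrite t0.
apply/seteqP; split=> e /=.
  by move=> /(@ltr_add_invr _ 0)[n]; rewrite add0r => /ltW; exists n.
by move=> [n _ /=]; apply: lt_le_trans; rewrite invr_gt0.
Qed.

End dimension.

Theorem theorem5p2 (R : realType) (d : measure_display)
    (Om : measurableType d) (P : probability Om R) (X : Om -> Dstar R)
    (hX : unimodular P X) (alpha c M : R)
    (halpha : 0 < alpha) (hc : 0 < c) (hM : 0 < M)
    (w : eqProcess (nneg_mark R)) (hw : process_on P X w)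
    (hball : process_as P X w (fun D o m => forall r : R, M <= r ->
       (weight_set m (nball r o) <= (c * r `^ alpha)%:E)%E)) :
  ((c^-1)%:E * process_E P X w (fun D o m => (weight m o)%:E)
     <= hausdorff_content P X M alpha)%E /\
  ((0 < process_P P X w (fun D o m => (0 < weight m o)%R))%E ->
     (udimH P X <= alpha%:E)%E).
Proof.
split; first exact: (hausdorff_content_ge hX hc hM hw hball).
move=> /(process_weight_gt0 hX.1 hw) Ew.
rewrite /udimH ge_max lee_fin (ltW halpha)/=.
apply: ge_ereal_sup => _ [a [a0 Ha] <-]; rewrite lee_fin leNgt.
(* If a exceeded alpha, the content at alpha would vanish too, against the positive lower bound
   obtained below. *)
apply/negP => /ltW /(hausdorff_content_le P X); rewrite Ha.
(* The dimension uses radii from 1 on, the hypothesis only those from M on. For r between 1 and M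
   the ball lies in that of radius M, of weight at most c M^alpha, and r^alpha is at least 1; hence
   this constant. *)
pose c' := c * Num.max 1 (M `^ alpha).
have c'0 : 0 < c' by rewrite mulr_gt0// lt_max ltr01.
have hball' : process_as P X w (fun D o m => forall r : R, 1 <= r ->
    (weight_set m (nball r o) <= (c' * r `^ alpha)%:E)%E).
  apply: filterS hball => om; apply: filterS => e wball r r1.
  have r0 : 0 < r by exact: lt_le_trans r1.
  have [Mr|/ltW rM] := leP M r.
    apply: le_trans (wball r Mr) _; rewrite lee_fin ler_wpM2r ?powR_ge0//.
    by rewrite ler_peMr ?(ltW hc)// le_max lexx.
  apply: (@le_trans _ _ (weight_set (ep_val e) (nball M (origin_of (X om))))).
    apply: ge_ereal_sup => _ [F [finF Fr] <-]; apply: ereal_sup_ubound.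
    exists F => //; split=> // v /Fr[_ vr]; split=> //.
    exact: le_trans rM.
  apply: le_trans (wball M (lexx M)) _; rewrite lee_fin.
  rewrite /c' -mulrA ler_wpM2l ?(ltW hc)// -[leLHS]mulr1 ler_pM ?powR_ge0//.
    by rewrite le_max lexx orbT.
  by rewrite -[leLHS](powRr0 r) ler_powR// ltW.
have := hausdorff_content_ge hX c'0 ltr01 hw hball'.
move=> /le_trans h /h; apply/negP; rewrite -ltNge mule_gt0//.
by rewrite lte_fin invr_gt0.
Qed.
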